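(* Let $(X,\varrho)$ be a complete metric space and let $U$ be a strict m-process on $X$ possessing a backward bounded pullback attractor $\mathbb A=\{A(t):t\in\mathbb R\}$. If there exists $t_\star>0$ such that $$A(t)\subset U(t,t-t_\star;A(t-t_\star))\qquad\text{for all }t\in\mathbb R,$$ then, in fact, $$A(t)=U(t,s;A(s))\qquad\text{for all } s\le t,\ s,t\in\mathbb R.$$
   Context: $P(X)$ is the family of nonempty subsets of $X$, $\mathcal B(X)$ the family of nonempty bounded subsets of $X$, $\mathbb R_d=\{(s,t)\in\mathbb R^2: s\ge t\}$. For a point $y$ and sets $A,B\subset X$: $\mathrm{dist}(y,B)=\inf_{x\in B}\varrho(x,y)$ and $\mathrm{dist}(A,B)=\sup_{y\in A}\mathrm{dist}(y,B)$, with $\inf\emptyset=+\infty$. A strict m-process on $X$ is a map $U:\mathbb R_d\times X\to P(X)$, $(t,\tau,x)\mapsto U(t,\tau;x)$, such that (i) $U(t,t;x)=\{x\}$ for all $t\in\mathbb R$, $x\in X$; (ii) $U(t,\tau;x)=U(t,s;U(s,\tau;x))$ for all $t\ge s\ge\tau$, $x\in X$, where $U(t,s;A)=\bigcup_{y\in A}U(t,s;y)$. A nonautonomous set is a family $\{K(t)\subset X:t\in\mathbb R\}$; it is closed (compact) if every $K(t)$ is; it is backward bounded if $\bigcup_{t\le\tau}K(t)$ is bounded for every $\tau\in\mathbb R$. It is pullback attracting for $U$ if $\lim_{\tau\to-\infty}\mathrm{dist}(U(t,\tau;B),K(t))=0$ for every $t\in\mathbb R$ and $B\in\mathcal B(X)$.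 A pullback attractor for $U$ is a nonautonomous set that is compact, pullback attracting, and minimal in the class of closed pullback attracting nonautonomous sets (i.e. $A(t)\subset C(t)$ for all $t$ for every closed pullback attracting $\{C(t)\}$). *)

(* Defs.v *)
From HB Require Import structures.
From mathcomp Require Import all_boot all_order all_algebra.
From mathcomp Require Import all_classical all_reals all_analysis.

Set Implicit Arguments.
Unset Strict Implicit.
Unset Printing Implicit Defensive.

Import Order.TTheory GRing.Theory Num.Theory.
Import numFieldNormedType.Exports.

Local Open Scope classical_set_scope.
Local Open Scope ring_scope.

(* The library's [completeType] is pointed, which would exclude the empty
   space; completeness is therefore a predicate on [metricType]. *)
Definition complete_metric (R : realType) (X : metricType R) : Prop :=
  forall u : nat -> X, cauchy (u @ \oo) -> exists x : X, u @ \oo --> x.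

(* The library's [bounded_set] is only available in normed modules. *)
Definition metric_bounded (R : realType) (X : metricType R) (A : set X) : Prop :=
  exists M : R, forall x y : X, A x -> A y -> mdist x y <= M.

(* Extended-real valued, so that the infimum over the empty set is +oo. *)
Definition pt_dist (R : realType) (X : metricType R) (y : X) (B : set X)
    : \bar R :=
  ereal_inf [set (mdist x y)%:E | x in B].

Definition set_dist (R : realType) (X : metricType R) (A B : set X) : \bar R :=
  ereal_sup [set pt_dist y B | y in A].

(* A map R_d * X -> P(X) is represented by a function on R * R * X whose values
   U t tau x are only meaningful (and only constrained) when tau <= t. *)
Definition mp_image (R : realType) (X : Type) (U : R -> R -> X -> set X)
    (t s : R) (A : set X) : set X :=
  \bigcup_(y in A) U t s y.

Record strict_mprocess (R : realType) (X : Type) (U : R -> R -> X -> set X)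
    : Prop := {
  mp_nonempty : forall (t tau : R) (x : X), tau <= t -> U t tau x !=set0 ;
  mp_id : forall (t : R) (x : X), U t t x = [set x] ;
  mp_comp : forall (t s tau : R) (x : X), tau <= s -> s <= t ->
    U t tau x = mp_image U t s (U s tau x)
}.

Definition na_closed (R : realType) (X : metricType R) (K : R -> set X) : Prop :=
  forall t : R, closed (K t).

Definition na_compact (R : realType) (X : metricType R) (K : R -> set X) : Prop :=
  forall t : R, compact (K t).

Definition backward_bounded (R : realType) (X : metricType R) (K : R -> set X)
    : Prop :=
  forall tau : R, metric_bounded (\bigcup_(t in [set t : R | t <= tau]) K t).

Definition pullback_attracting (R : realType) (X : metricType R)
    (U : R -> R -> X -> set X) (K : R -> set X) : Prop :=
  forall (t : R) (B : set X), B !=set0 -> metric_bounded B ->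
    set_dist (mp_image U t tau B) (K t) @[tau --> -oo] --> 0%E.

Record pullback_attractor (R : realType) (X : metricType R)
    (U : R -> R -> X -> set X) (A : R -> set X) : Prop := {
  pa_compact : na_compact A ;
  pa_attracting : pullback_attracting U A ;
  pa_minimal : forall C : R -> set X,
    na_closed C -> pullback_attracting U C -> forall t : R, A t `<=` C t
}.

(* Main.v *)
Require Import Defs.
From HB Require Import structures.
From mathcomp Require Import all_boot all_order all_algebra.
From mathcomp Require Import all_classical all_reals all_analysis.

Import Order.TTheory GRing.Theory Num.Theory.
Import numFieldNormedType.Exports.

Local Open Scope classical_set_scope.
Local Open Scope ring_scope.

(** Write [h] for the step [tstar] of the covering hypothesis.  By the cocycle
    law the hypothesis iterates: [A t] is covered by the image at time [t] of
    [A (t - h *+ n)], for every [n] ([negatively_covered_iter]).  So each point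
    of [A s] has ancestors in the attractor at arbitrarily remote times.

    Backward boundedness puts all these ancestors into one bounded set [B], the
    union of the [A r] with [r <= s].  A point of the image of [A s] at a time
    [t >= s] is then reached from [B] starting arbitrarily far in the past; the
    attractor attracts [B] at time [t] and [A t] is closed, so that point lies
    in [A t].  This gives positive invariance ([covered_attractor_invariant]).

    Conversely, take [n] with [t - h *+ n <= s].  A point of [A t] is reached
    from a point of [A (t - h *+ n)] through some state at the intermediate
    time [s]; by positive invariance this state is in [A s]. *)

Set Implicit Arguments.
Unset Strict Implicit.

Lemma closure_pt_dist (R : realType) (X : metricType R) (y : X) (B : set X) :
  (forall e : R, 0 < e -> (pt_dist y B < e%:E)%E) -> closure B y.
Proof.
move=> yB V /nbhs_ballP[e /= e0 yeV].
have [_ [x Bx <-]] := ereal_inf_lt (yB e e0).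
rewrite lte_fin => xye; exists x; split=> //.
by apply/yeV/ball_sym; rewrite ballEmdist.
Qed.

Section Process.
Context (R : realType).

Section Composition.
Context (X : Type) (U : R -> R -> X -> set X).

Lemma mp_image_subset (t s : R) (B C : set X) :
  B `<=` C -> mp_image U t s B `<=` mp_image U t s C.
Proof. exact: bigcup_subset. Qed.

Hypothesis hU : strict_mprocess U.

Lemma mp_image_id (t : R) (B : set X) : mp_image U t t B = B.
Proof.
rewrite /mp_image; under eq_bigcupr do rewrite (mp_id hU).
by rewrite bigcup_imset1 image_id.
Qed.

Lemma mp_image_comp (t s tau : R) (B : set X) : tau <= s -> s <= t ->
  mp_image U t tau B = mp_image U t s (mp_image U s tau B).
Proof.
move=> taus st; apply/seteqP; split=> z.
- move=> [x Bx]; rewrite (mp_comp hU _ taus st) => -[y sy yz].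
  by exists y => //; exists x.
- move=> [y [x Bx xy] yz]; exists x => //.
  by rewrite (mp_comp hU _ taus st); exists y.
Qed.

Lemma negatively_covered_iter (A : R -> set X) (h : R) : 0 <= h ->
  (forall t, A t `<=` mp_image U t (t - h) (A (t - h))) ->
  forall (n : nat) (t : R),
    A t `<=` mp_image U t (t - h *+ n) (A (t - h *+ n)).
Proof.
move=> h0 cov; elim=> [|n IHn] t.
  by rewrite mulr0n subr0 mp_image_id.
rewrite mulrSr opprD addrA (mp_image_comp (s := t - h *+ n)).
- exact/(subset_trans (IHn t))/mp_image_subset/cov.
- by rewrite lerBlDr lerDl.
- by rewrite lerBlDr lerDl mulrn_wge0.
Qed.

End Composition.

Lemma exists_natmul_lt (h r M : R) : 0 < h -> exists n : nat, r - h *+ n < M.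
Proof.
move=> h0; exists (Num.bound `|(r - M) / h|).
have : (r - M) / h < (Num.bound `|(r - M) / h|)%:R.
  exact: le_lt_trans (ler_norm _) (archi_boundP (normr_ge0 _)).
by rewrite ltr_pdivrMr// mulr_natl ltrBlDr ltrBlDl addrC.
Qed.

Context (X : metricType R) (U : R -> R -> X -> set X).

(** Attraction only controls the distance to [K t] in the limit of remote
    starting times, so a point that is reached from one bounded set for
    unboundedly many such times is at distance zero from [K t].  The set [B] is
    nonempty because it reaches [y]. *)
Lemma attracting_absorbs_frequent (K : R -> set X) (B : set X) (t : R) (y : X) :
  pullback_attracting U K -> closed (K t) -> metric_bounded B ->
  (forall M : R, exists2 tau : R, tau < M & mp_image U t tau B y) ->
  K t y.
Proof.
move=> attr Kcl Bbd freq; apply/Kcl/closure_pt_dist => e e0.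
have B0 : B !=set0 by have [tau _ [x Bx _]] := freq 0; exists x.
have near0 : nbhs (0 : \bar R)%E [set z | (z < e%:E)%E].
  by apply: open_nbhs_nbhs; split; [exact: open_ereal_lt_ereal|rewrite /= lte_fin].
have [M [_ /= MP]] := attr t B B0 Bbd _ near0.
have [tau tauM ytau] := freq M.
have /= := MP tau tauM; apply: le_lt_trans.
by apply: ereal_sup_ubound; exists y.
Qed.

Hypothesis hU : strict_mprocess U.

(** The covering moves the starting time of a trajectory ending in the image of
    [A s] back without bound, while backward boundedness keeps all the starting
    points in a single bounded set, as attraction requires. *)
Lemma covered_attractor_invariant (A : R -> set X) (h : R) :
  (forall t, closed (A t)) -> pullback_attracting U A -> backward_bounded A ->
  0 < h -> (forall t, A t `<=` mp_image U t (t - h) (A (t - h))) ->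
  forall s t : R, s <= t -> mp_image U t s (A s) `<=` A t.
Proof.
move=> Acl attr Abd h0 cov s t st y yts.
apply: (attracting_absorbs_frequent attr (Acl t) (Abd s)) => M.
have [n nM] := exists_natmul_lt s M h0.
have ns : s - h *+ n <= s by rewrite lerBlDr lerDl mulrn_wge0// ltW.
exists (s - h *+ n) => //.
have : mp_image U t s (mp_image U s (s - h *+ n) (A (s - h *+ n))) y.
  apply: (mp_image_subset _ yts).
  exact: (negatively_covered_iter hU (ltW h0) cov).
rewrite -mp_image_comp//; apply: mp_image_subset => x Ax.
by exists (s - h *+ n).
Qed.

End Process.

Unset Implicit Arguments.
Set Strict Implicit.

Theorem proposition4p3 (R : realType) (X : metricType R)
    (hX : complete_metric X)
    (U : R -> R -> X -> set X) (hU : strict_mprocess U)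
    (A : R -> set X) (hA : pullback_attractor U A)
    (hAb : backward_bounded A)
    (hstar : exists2 tstar : R, 0 < tstar &
       forall t : R, A t `<=` mp_image U t (t - tstar) (A (t - tstar))) :
  forall s t : R, s <= t -> A t = mp_image U t s (A s).
Proof.
have [h h0 cov] := hstar.
have Acl t : closed (A t).
  by apply: compact_closed; [exact: metric_hausdorff|exact: (pa_compact hA)].
have inv := covered_attractor_invariant hU Acl (pa_attracting hA) hAb h0 cov.
move=> s t st; apply/seteqP; split; last exact: inv.
have [n /ltW ns] := exists_natmul_lt t s h0.
have past := negatively_covered_iter hU (ltW h0) cov.
apply: (subset_trans (past n t)).
rewrite (mp_image_comp hU (s := s))//.
exact/mp_image_subset/inv.
Qed.
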